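(* Let $A\subset\mathbb R^n$ be a finite set, $\Omega=\mathrm{conv}(A)$, and let $D=\mathrm{diam}(\Omega)>0$. Then $$\mathrm{SB}_{\mathrm{PFW}}(\Omega)\ge\frac{\mathrm{PWidth}(A)}{D},\qquad \mathrm{SB}_{\mathrm{AFW}}(\Omega)\ge\frac{\mathrm{PWidth}(A)}{2D},\qquad \mathrm{SB}_{\mathrm{FD}}(\Omega)\ge\frac{\mathrm{PWidth}(V(\Omega))}{2D},$$ where $V(\Omega)$ is the set of vertices of $\Omega$.
   Context: $T_\Omega(x)$ is the tangent cone of $\Omega$ at $x$, $\pi(C,\cdot)$ the Euclidean projection on $C$, $\pi_x(g)=\|\pi(T_\Omega(x),g)\|$. Slope bound. For a method $\mathcal M$ with set of possible directions $\mathcal M(x,g)$ at $x\in\Omega$ for the gradient $-g$ (with the convention $\mathcal M(x,g)=\{0\}$ when $\pi_x(g)=0$), $\mathrm{DSB}_{\mathcal M}(\Omega,x,g)=\inf_{d\in\mathcal M(x,g)}\frac{\langle g,d\rangle}{\pi_x(g)\|d\|}$ if $\pi_x(g)\neq0$ and $=1$ otherwise; $\mathrm{SB}_{\mathcal M}(\Omega)=\inf_{x\in\Omega,g\in\mathbb R^n}\mathrm{DSB}_{\mathcal M}(\Omega,x,g)$. Directions. For $x\in\Omega$ let $S_x$ be the family of sets $S\subset A$ such that $x$ is a proper convex combination (all weights strictly positive) of all the elements of $S$. FW direction: $d^{\mathrm{FW}}=s-x$ with $s\in\mathrm{argmax}_{s\in\Omega}\langle s,g\rangle$. PFW directions at $(x,g)$: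 $d^{\mathrm{PFW}}=s-q$ with $s\in\mathrm{argmax}_{s\in\Omega}\langle s,g\rangle$, $q\in\mathrm{argmin}_{q\in S}\langle q,g\rangle$, for some $S\in S_x$. AFW directions at $(x,g)$: $d^{\mathrm{AFW}}\in\mathrm{argmax}\{\langle g,d\rangle: d\in\{d^{\mathrm{FW}},x-q\}\}$ with $q\in\mathrm{argmin}_{q\in S}\langle q,g\rangle$, for some $S\in S_x$. FD (FDFW, Frank-Wolfe with in face directions) at $(x,g)$: $d^{\mathrm{FD}}\in\mathrm{argmax}\{\langle g,d\rangle: d\in\{d^A,d^{\mathrm{FW}}\}\}$, where $d^A=x-x_A$, $x_A\in\mathrm{argmin}\{\langle g,y\rangle: y\in\mathcal F(x)\}$ and $\mathcal F(x)$ is the minimal face of $\Omega$ containing $x$. Pyramidal width. For a finite set $A$, with $S_x$ the family above relative to $A$, and $g\neq0$: $\mathrm{PdirW}(A,g,x)=\min_{S\in S_x}\max_{a\in A,\,s\in S}\langle\frac g{\|g\|},a-s\rangle$, and $$\mathrm{PWidth}(A)=\min_{\substack{F\in\mathrm{faces}(\mathrm{conv}(A)),\ x\in F\\ g\in\mathrm{cone}(F-x)\setminus\{0\}}}\mathrm{PdirW}(F\cap A,g,x).$$ *)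

(* Defs.v *)
From HB Require Import structures.
From mathcomp Require Import all_boot all_order all_algebra.
From mathcomp Require Import all_classical all_reals all_analysis.

Set Implicit Arguments.
Unset Strict Implicit.
Unset Printing Implicit Defensive.

Import Order.TTheory GRing.Theory Num.Theory.
Import numFieldNormedType.Exports.

Local Open Scope classical_set_scope.
Local Open Scope ring_scope.

Definition dot (R : realType) (n : nat) (u v : 'rV[R]_n) : R :=
  \sum_(i < n) u 0 i * v 0 i.

(* The library norm on ['rV[R]_n] is the sup norm, hence this Euclidean one. *)
Definition enorm (R : realType) (n : nat) (u : 'rV[R]_n) : R :=
  Num.sqrt (dot u u).

Definition diameter (R : realType) (n : nat) (C : set 'rV[R]_n) : R :=
  sup [set enorm (x - y) | x in C & y in C].

Definition argmax (R : realType) (n : nat) (C : set 'rV[R]_n)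
    (f : 'rV[R]_n -> R) : set 'rV[R]_n :=
  [set x | C x /\ forall y, C y -> f y <= f x].

Definition argmin (R : realType) (n : nat) (C : set 'rV[R]_n)
    (f : 'rV[R]_n -> R) : set 'rV[R]_n :=
  [set x | C x /\ forall y, C y -> f x <= f y].

Definition conv_hull (R : realType) (n : nat) (A : set 'rV[R]_n) : set 'rV[R]_n :=
  smallest (@convex_set R 'rV[R]_n) A.

Definition face (R : realType) (n : nat) (C F : set 'rV[R]_n) : Prop :=
  [/\ F `<=` C, @convex_set R 'rV[R]_n F &
      forall (x y : 'rV[R]_n) (t : R), C x -> C y -> 0 < t < 1 ->
        F (t *: x + (1 - t) *: y) -> F x /\ F y].

Definition minface (R : realType) (n : nat) (C : set 'rV[R]_n)
    (x : 'rV[R]_n) : set 'rV[R]_n :=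
  smallest (face C) [set x].

Definition vertices (R : realType) (n : nat) (C : set 'rV[R]_n) :
    set 'rV[R]_n :=
  [set v | face C [set v]].

(* cone(C - x); C is always convex here, so multiples of single points of
   C - x are enough to get the convex cone it generates. *)
Definition cone_at (R : realType) (n : nat) (C : set 'rV[R]_n)
    (x : 'rV[R]_n) : set 'rV[R]_n :=
  [set t *: (y - x) | t in [set t : R | 0 <= t] & y in C].

(* Tangent cone of a convex set; [closure] is taken for the product topology
   of ['rV[R]_n], which is the Euclidean one. *)
Definition tangent_cone (R : realType) (n : nat) (C : set 'rV[R]_n)
    (x : 'rV[R]_n) : set 'rV[R]_n :=
  closure (cone_at C x).

(* The nearest point, which exists and is unique when C is nonempty, closed
   and convex. *)
Definition eproj (R : realType) (n : nat) (C : set 'rV[R]_n)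
    (g : 'rV[R]_n) : 'rV[R]_n :=
  xget 0 (argmin C (fun p => enorm (g - p))).

Definition proj_norm (R : realType) (n : nat) (Omega : set 'rV[R]_n)
    (x g : 'rV[R]_n) : R :=
  enorm (eproj (tangent_cone Omega x) g).

(* [M x g] is the set of possible directions at x for the gradient -g. *)
Definition method (R : realType) (n : nat) : Type :=
  'rV[R]_n -> 'rV[R]_n -> set 'rV[R]_n.

Definition DSB (R : realType) (n : nat) (Omega : set 'rV[R]_n)
    (M : method R n) (x g : 'rV[R]_n) : \bar R :=
  if proj_norm Omega x g == 0 then 1%E
  else ereal_inf
    [set (dot g d / (proj_norm Omega x g * enorm d))%:E | d in M x g].

Definition SB (R : realType) (n : nat) (Omega : set 'rV[R]_n)
    (M : method R n) : \bar R :=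
  ereal_inf [set DSB Omega M x g | x in Omega & g in [set: 'rV[R]_n]].

Definition zero_if_stationary (R : realType) (n : nat)
    (Omega : set 'rV[R]_n) (M : method R n) : method R n :=
  fun x g => if proj_norm Omega x g == 0 then [set 0] else M x g.

(* The family S_x relative to A. *)
Definition active_sets (R : realType) (n : nat) (A : set 'rV[R]_n)
    (x : 'rV[R]_n) : set (set 'rV[R]_n) :=
  [set S | S `<=` A /\
    exists w : 'rV[R]_n -> R,
      [/\ forall s, S s -> 0 < w s,
          \sum_(s \in S) w s = 1 &
          \sum_(s \in S) w s *: s = x]].

Definition FW_dirs (R : realType) (n : nat) (Omega : set 'rV[R]_n) :
    method R n :=
  fun x g => [set s - x | s in argmax Omega (dot g)].

Definition PFW (R : realType) (n : nat) (A : set 'rV[R]_n) : method R n :=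
  zero_if_stationary (conv_hull A) (fun x g =>
    [set d | exists s S q,
       [/\ argmax (conv_hull A) (dot g) s, active_sets A x S,
           argmin S (dot g) q & d = s - q]]).

Definition AFW (R : realType) (n : nat) (A : set 'rV[R]_n) : method R n :=
  zero_if_stationary (conv_hull A) (fun x g =>
    [set d | exists dFW S q,
       [/\ FW_dirs (conv_hull A) x g dFW, active_sets A x S,
           argmin S (dot g) q & argmax [set dFW; x - q] (dot g) d]]).

Definition FD (R : realType) (n : nat) (Omega : set 'rV[R]_n) : method R n :=
  zero_if_stationary Omega (fun x g =>
    [set d | exists dFW xA,
       [/\ FW_dirs Omega x g dFW, argmin (minface Omega x) (dot g) xA &
           argmax [set x - xA; dFW] (dot g) d]]).

Definition PdirW (R : realType) (n : nat) (A : set 'rV[R]_n)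
    (g x : 'rV[R]_n) : \bar R :=
  ereal_inf
    [set ereal_sup
           [set (dot ((enorm g)^-1 *: g) (a - s))%:E | a in A & s in S]
     | S in active_sets A x].

(* The minimum over (F, x, g) is attained for A finite with at least two
   points, so it is rendered as an infimum. *)
Definition PWidth (R : realType) (n : nat) (A : set 'rV[R]_n) : \bar R :=
  ereal_inf
    [set r | exists (F : set 'rV[R]_n) (x g : 'rV[R]_n),
       [/\ face (conv_hull A) F, F x, cone_at F x g, g != 0 &
           r = PdirW (F `&` A) g x]].

(* Main.v *)
Require Import Defs.
From mathcomp Require Import all_boot all_order all_algebra.
From mathcomp Require Import all_classical all_reals all_analysis.
From mathcomp Require Import ring lra.

Set Implicit Arguments.
Unset Strict Implicit.
Unset Printing Implicit Defensive.

Import Order.TTheory GRing.Theory Num.Theory.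
Import numFieldNormedType.Exports.

Local Open Scope classical_set_scope.
Local Open Scope ring_scope.

(** Fix [x] in the polytope [Om], let [r] be the projection of [g] on the
    tangent cone at [x], suppose [r != 0], and put [u = g - r]. By Moreau's
    decomposition [u] is orthogonal to [r] and [dot u (y - x) <= 0] on [Om], so
    that [F = {y in Om | dot u (y - x) = 0}] is a face of [Om] which contains
    [x]. Two facts make [F] the right face to use in the pyramidal width:

    - [r] lies in [cone (F - x)], because [r = t (y - x)] with [y] in [Om] and
      [dot u r = 0];
    - every active set [S] of [x] is contained in [F], because [F] is a face.

    On [F] the linear forms [dot g] and [dot r] differ by a constant. Hence
    [|r| * PWidth A <= |r| * PdirW (F & A) r x], which is at most the maximum of
    [dot r (a - s)], equal to [dot g (a - s)], over [a] in [F & A] and [s] in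
    [S]. That is at most the slope [dot g (s - q)] of the pairwise direction
    given by [S]; this is [PWidth_le_proj].

    All three bounds follow from it. The pairwise direction has length at most
    the diameter. Away-step and in-face directions have at least half of the
    slope of a pairwise direction, since [s - q = (s - x) + (x - q)]. For
    in-face directions the active set is one made of vertices, which exists
    because [Om] is the convex hull of its vertices ([conv_hull_vertices]) and
    lies in the minimal face of [x]; minimizing over the whole minimal face only
    increases the slope. At stationary points the bound reduces to
    [PWidth A <= diameter Om].

    The fact [r = t (y - x)] needs the cone of [Om - x] to be closed. Closedness
    is obtained by exhibiting in a finitely generated cone a point that satisfies
    the optimality conditions of the projection ([cone_projection]): this point is
    then also the projection on the closure. *)

(** * Euclidean inner product *)

Section Euclidean.
Variables (R : realType) (n : nat).
Implicit Types (u v w : 'rV[R]_n) (a : R).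

Lemma dotC u v : dot u v = dot v u.
Proof. by apply: eq_bigr => i _; rewrite mulrC. Qed.

Lemma dotDr u v w : dot u (v + w) = dot u v + dot u w.
Proof. by rewrite -big_split; apply: eq_bigr => i _; rewrite mxE mulrDr. Qed.

Lemma dotZr u a v : dot u (a *: v) = a * dot u v.
Proof. by rewrite /dot big_distrr; apply: eq_bigr => i _ /=; rewrite mxE mulrCA. Qed.

Lemma dotNr u v : dot u (- v) = - dot u v.
Proof. by rewrite -scaleN1r dotZr mulN1r. Qed.

Lemma dot0r u : dot u 0 = 0.
Proof. by rewrite -(scale0r u) dotZr mul0r. Qed.

Lemma dotDl u v w : dot (v + w) u = dot v u + dot w u.
Proof. by rewrite dotC dotDr !(dotC u). Qed.

Lemma dotZl u a v : dot (a *: v) u = a * dot v u.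
Proof. by rewrite dotC dotZr (dotC u). Qed.

Lemma dotNl u v : dot (- v) u = - dot v u.
Proof. by rewrite dotC dotNr (dotC u). Qed.

Lemma dot0l u : dot 0 u = 0.
Proof. by rewrite dotC dot0r. Qed.

Definition dotE := (dotDl, dotDr, dotNl, dotNr, dotZl, dotZr, dot0l, dot0r).

Lemma dot_sumr u (I : Type) (s : seq I) (f : I -> 'rV[R]_n) :
  dot u (\sum_(i <- s) f i) = \sum_(i <- s) dot u (f i).
Proof. exact: (big_morph (dot u) (dotDr u) (dot0r u)). Qed.

Lemma dot_ge0 u : 0 <= dot u u.
Proof. by apply: sumr_ge0 => i _; rewrite -expr2 sqr_ge0. Qed.

Lemma dot_eq0 u : (dot u u == 0) = (u == 0).
Proof.
apply/eqP/eqP => [u0|->]; last exact: dot0r.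
apply/rowP => i; rewrite mxE; apply/eqP; rewrite -sqrf_eq0 expr2; apply/eqP.
by apply: (psumr_eq0P _ u0) => // j _; rewrite -expr2 sqr_ge0.
Qed.

Lemma enorm_ge0 u : 0 <= enorm u.
Proof. exact: sqrtr_ge0. Qed.

Lemma enorm_eq0 u : (enorm u == 0) = (u == 0).
Proof. by rewrite /enorm sqrtr_eq0 -dot_eq0 eq_le dot_ge0 andbT. Qed.

Lemma enorm_sqr u : enorm u ^+ 2 = dot u u.
Proof. by rewrite /enorm sqr_sqrtr ?dot_ge0. Qed.

Lemma enorm_le u v : (enorm u <= enorm v) = (dot u u <= dot v v).
Proof. by rewrite /enorm ler_sqrt ?dot_ge0. Qed.

(** Expand [|  |v| u - |u| v |^2 >= 0] and divide by [2 |u| |v|]. *)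
Lemma cauchy_schwarz u v : dot u v <= enorm u * enorm v.
Proof.
have [->|u0] := eqVneq u 0; first by rewrite dot0l mulr_ge0 ?enorm_ge0.
have [->|v0] := eqVneq v 0; first by rewrite dot0r mulr_ge0 ?enorm_ge0.
have up : 0 < enorm u by rewrite lt_neqAle eq_sym enorm_eq0 u0 enorm_ge0.
have vp : 0 < enorm v by rewrite lt_neqAle eq_sym enorm_eq0 v0 enorm_ge0.
have := dot_ge0 (enorm v *: u - enorm u *: v).
rewrite !dotE (dotC v u) -!enorm_sqr => h.
rewrite -(ler_pM2l (mulr_gt0 up vp)); nra.
Qed.

Lemma continuous_dot u : continuous (dot u).
Proof.
suff dot_s (s : seq 'I_n) :
    continuous (fun v : 'rV[R]_n => \sum_(i <- s) u 0 i * v 0 i) by exact: dot_s.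
elim: s => [|i s IHs].
  rewrite (_ : (fun _ => _) = cst 0); first exact: cst_continuous.
  by apply/funext => v; rewrite big_nil.
rewrite (_ : (fun _ => _) = (fun v : 'rV[R]_n =>
  u 0 i * v 0 i + \sum_(j <- s) u 0 j * v 0 j)); last first.
  by apply/funext => v; rewrite big_cons.
move=> x; apply: (@cvgD _ _ _ (nbhs x)); last exact: IHs.
by apply: (@cvgM _ _ (nbhs x)); [exact: cvg_cst|exact: coord_continuous].
Qed.

Lemma closed_halfspace u : closed [set v | dot u v <= 0].
Proof.
apply: (@preimage_closed _ _ (dot u) [set a | a <= 0]); last exact: closed_le.
by move=> x _; apply: continuous_dot.
Qed.

End Euclidean.

(** * Convex combinations, active sets and faces *)

Section ConvexSets.
Variables (R : realType) (n : nat).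
Implicit Types (C F : set 'rV[R]_n) (x y : 'rV[R]_n) (t : R).

Lemma convex_setE C :
  @convex_set R 'rV[R]_n C <->
  forall x y t, C x -> C y -> 0 <= t -> t <= 1 -> C (t *: x + (1 - t) *: y).
Proof.
split=> [cC x y t Cx Cy t0 t1|cC x y t /set_mem Cx /set_mem Cy].
  have /set_mem := cC x y (Itv01 t0 t1) (mem_set Cx) (mem_set Cy).
  exact.
by apply/mem_set; apply: cC.
Qed.

(** Induction on the number of points, on the normalized partial sums; these
    make sense only once the partial sum of the weights is positive. *)
Lemma convex_sum (I : eqType) (s : seq I) (w : I -> R) (v : I -> 'rV[R]_n) C :
  @convex_set R 'rV[R]_n C ->
  (forall i, i \in s -> 0 <= w i) -> (forall i, i \in s -> C (v i)) ->
  \sum_(i <- s) w i = 1 -> C (\sum_(i <- s) w i *: v i).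
Proof.
move=> /convex_setE cC w0 vC w1.
suff : 0 < \sum_(i <- s) w i ->
    C ((\sum_(i <- s) w i)^-1 *: \sum_(i <- s) w i *: v i).
  by rewrite w1 invr1 scale1r; apply.
elim: s w0 vC {w1} => [|i s IHs] w0 vC; first by rewrite big_nil ltxx.
have wi0 : 0 <= w i by apply: w0; rewrite mem_head.
have Cvi : C (v i) by apply: vC; rewrite mem_head.
have w0' j : j \in s -> 0 <= w j by move=> js; rewrite w0 // inE js orbT.
have vC' j : j \in s -> C (v j) by move=> js; apply: vC; rewrite inE js orbT.
rewrite !big_cons.
have : 0 <= \sum_(j <- s) w j by rewrite big_seq; apply: sumr_ge0.
rewrite le_eqVlt => /orP[/eqP ws0|ws0].
  have -> : \sum_(j <- s) w j *: v j = 0.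
    rewrite big_seq big1 // => j js.
    suff -> : w j = 0 by rewrite scale0r.
    move/esym/eqP: ws0; rewrite big_seq psumr_eq0 // => /allP/(_ j js).
    by rewrite js => /eqP.
  rewrite -ws0 !addr0 => wi; rewrite scalerA mulVf ?gt_eqF //.
  by rewrite scale1r.
move=> W0; set W := w i + _.
have Wneq0 : W != 0 by rewrite gt_eqF.
have -> : W^-1 *: (w i *: v i + \sum_(j <- s) w j *: v j) =
    (w i / W) *: v i + (1 - w i / W) *:
      ((\sum_(j <- s) w j)^-1 *: \sum_(j <- s) w j *: v j).
  rewrite scalerDr !scalerA; congr (_ *: _ + _ *: _); first by rewrite mulrC.
  rewrite /W; field; rewrite -/W Wneq0 gt_eqF //.
apply: cC => //; first exact: IHs.
  by rewrite divr_ge0 // ltW.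
by rewrite ler_pdivrMr // mul1r /W lerDl ltW.
Qed.

Lemma convex_conv_hull (A : set 'rV[R]_n) : @convex_set R 'rV[R]_n (conv_hull A).
Proof.
apply/convex_setE => x y t Ax Ay t0 t1 C [cC AC].
by move/convex_setE: (cC); apply => //; [apply: Ax|apply: Ay].
Qed.

Lemma sub_conv_hull (A : set 'rV[R]_n) : A `<=` conv_hull A.
Proof. exact: sub_gen_smallest. Qed.

Lemma convex_halfspace u x a : @convex_set R 'rV[R]_n [set y | dot u (y - x) <= a].
Proof.
apply/convex_setE => y z t /=; rewrite !dotE; nra.
Qed.

(** The set of all convex combinations of [s] is itself convex. *)
Lemma conv_hull_combo (s : seq 'rV[R]_n) x : uniq s ->
  conv_hull [set` s] x -> exists w : 'rV[R]_n -> R,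
   [/\ forall b, 0 <= w b, \sum_(b <- s) w b = 1 & \sum_(b <- s) w b *: b = x].
Proof.
move=> us; pose C := [set x : 'rV[R]_n | exists w : 'rV[R]_n -> R,
   [/\ forall b, 0 <= w b, \sum_(b <- s) w b = 1 & \sum_(b <- s) w b *: b = x]].
apply: (@smallest_sub _ _ _ C).
  apply/convex_setE => y z t [w [w0 w1 <-]] [w' [w'0 w'1 <-]] t0 t1.
  exists (fun b => t * w b + (1 - t) * w' b); split.
  - by move=> b; rewrite addr_ge0 // mulr_ge0 // subr_ge0.
  - by rewrite big_split /= -!big_distrr /= w1 w'1; ring.
  - under eq_bigr do rewrite scalerDl -!scalerA.
    by rewrite big_split /= !scaler_sumr.
move=> a /= sa; exists (fun b => (b == a)%:R); split.
- by move=> b; rewrite ler0n.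
- rewrite (bigD1_seq a) //= eqxx big1 ?addr0 // => b /negPf ->; exact: erefl.
- rewrite (bigD1_seq a) //= eqxx big1 ?addr0 ?scale1r // => b /negPf ->.
  by rewrite scale0r.
Qed.

Lemma finite_uniq_seq (A : set 'rV[R]_n) : finite_set A ->
  exists2 s : seq 'rV[R]_n, uniq s & A = [set` s].
Proof.
move=> /finite_seqP[s ->]; exists (undup s); first exact: undup_uniq.
by apply/seteqP; split=> b /=; rewrite mem_undup.
Qed.

Lemma active_set_combo (A S : set 'rV[R]_n) x : finite_set A ->
  active_sets A x S -> exists s (w : 'rV[R]_n -> R),
    [/\ uniq s /\ S = [set` s], forall b, b \in s -> 0 < w b,
        \sum_(b <- s) w b = 1 & \sum_(b <- s) w b *: b = x].
Proof.
move=> finA [SA [w [w0 w1 wx]]].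
have [s us Ss] := finite_uniq_seq (sub_finite_set SA finA).
exists s, w; split=> //; subst S; first by move=> b bs; apply: w0.
  by rewrite (fsbig_seq _ _ us).
by rewrite (fsbig_seq _ _ us).
Qed.

(** Keep the points of positive weight in a convex combination. *)
Lemma active_set_exists (A : set 'rV[R]_n) x : finite_set A ->
  conv_hull A x -> exists S, active_sets A x S.
Proof.
move=> finA; have [s us ->] := finite_uniq_seq finA.
move=> /(conv_hull_combo us) [w [w0 w1 wx]].
pose s' := [seq b <- s | 0 < w b].
have us' : uniq s' by rewrite filter_uniq.
have w'0 b : ~~ (0 < w b) -> w b = 0.
  by rewrite -leNgt => wb; apply/eqP; rewrite eq_le wb w0.
exists [set` s']; split.
  by move=> b; rewrite /= mem_filter => /andP[].
exists w; split.
- by move=> b; rewrite /= mem_filter => /andP[].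
- rewrite -(fsbig_seq _ _ us') -w1 big_filter [RHS](bigID (fun b => 0 < w b)) /=.
  by rewrite [X in _ = _ + X]big1 ?addr0.
- rewrite -(fsbig_seq _ _ us') -wx big_filter [RHS](bigID (fun b => 0 < w b)) /=.
  rewrite [X in _ = _ + X]big1 ?addr0 // => b wb.
  by rewrite w'0 // scale0r.
Qed.

(** A point [b] of positive weight in [x] makes [x] an interior point of a segment
    from [b] to another point of the hull: move half of the weight of [b] to
    the end [b], and let the other end carry the rest. *)
Lemma active_set_sub_face (A S F : set 'rV[R]_n) x : finite_set A ->
  face (conv_hull A) F -> F x -> active_sets A x S -> S `<=` F.
Proof.
move=> finA [_ _ faceF] Fx aS b Sb; have [SA _] := aS.
have [s [w [[us Ss] w0 w1 wx]]] := active_set_combo finA aS.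
have bs : b \in s by move: Sb; rewrite Ss.
have wb0 := w0 _ bs.
have wb1 : w b <= 1.
  rewrite -w1 (bigD1_seq b) //= lerDl big_seq_cond.
  by apply: sumr_ge0 => c /andP[cs _]; apply/ltW/w0.
(* Half the weight of [b], so that [t < 1] even when [b] carries it all. *)
set t := w b / 2; pose w' c := if c == b then t / (1 - t) else w c / (1 - t).
have t01 : 0 < t < 1 by rewrite /t; lra.
have t1 : 1 - t != 0 by rewrite gt_eqF // subr_gt0; case/andP: t01.
have w'off c : c != b -> w' c = (1 - t)^-1 * w c.
  by move=> /negPf cb; rewrite /w' cb mulrC.
pose y := \sum_(c <- s) w' c *: c.
have Cy : conv_hull A y.
  apply: convex_sum => //; first exact: convex_conv_hull.
  - move=> c cs; rewrite /w'; case: eqP => _; rewrite divr_ge0 //; try lra.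
    exact/ltW/w0.
  - by move=> c cs; apply: sub_conv_hull; apply: SA; rewrite Ss.
  - rewrite (bigD1_seq b) //= /w' eqxx.
    under eq_bigr => c cb do rewrite (negPf cb) mulrC.
    move: w1; rewrite (bigD1_seq b) //= -big_distrr /= => w1.
    have -> : \sum_(i <- s | i != b) w i = 1 - 2 * t by rewrite /t; lra.
    by field.
have xE : t *: b + (1 - t) *: y = x.
  rewrite -wx /y (bigD1_seq b) //= [RHS](bigD1_seq b) //= scalerDr addrA.
  congr (_ + _).
    rewrite /w' eqxx scalerA -scalerDl; congr (_ *: _); rewrite mulrC mulfVK //.
    by rewrite /t; lra.
  rewrite scaler_sumr; apply: eq_bigr => c cb.
  by rewrite w'off // scalerA mulrA mulfV // mul1r.
have := faceF b y t (sub_conv_hull (SA _ Sb)) Cy t01.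
by rewrite xE => /(_ Fx) [].
Qed.

End ConvexSets.
(** * Projection on the tangent cone and the key inequality *)

Section Cones.
Variables (R : realType) (n : nat).
Implicit Types (C : set 'rV[R]_n) (x y g p q : 'rV[R]_n).

Lemma dot_sub_residuals g p q :
  dot (p - q) (p - q) =
    dot (g - q) p - dot (g - q) q - dot (g - p) p + dot (g - p) q.
Proof. by rewrite !dotE (dotC q p); ring. Qed.

Lemma dot_sub_sub g p z :
  dot (g - z) (g - z) =
    dot (g - p) (g - p) + 2 * dot (g - p) (p - z) + dot (p - z) (p - z).
Proof. by rewrite !dotE (dotC z g) (dotC z p) (dotC p g); ring. Qed.

(** A finitely generated cone contains a point [p] such that [g - p] is orthogonal
    to [p] and in the polar cone. The proof is by induction on the number of
    generators. Let [q] be the point given for the first [k] of them. If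
    [g - q] makes no acute angle with the last generator [u], then [q] still
    works. Otherwise the constraint on the coefficient of [u] must be inactive: solve
    the problem for the projections orthogonal to [u], then add the multiple
    [d *: u] of [u] that makes the residual orthogonal to [u]. The optimality
    conditions at [p] and [q] give [|p - q|^2 <= d * dot (g - q) u],
    whence [d >= 0]. *)
Lemma cone_projection k (v : nat -> 'rV[R]_n) g :
  exists2 c : nat -> R, forall i, 0 <= c i &
    let p := \sum_(i < k) c i *: v i in
    dot (g - p) p = 0 /\ forall i, (i < k)%N -> dot (g - p) (v i) <= 0.
Proof.
elim: k v g => [|k IHk] v g.
  by exists (fun=> 0) => //=; rewrite big_ord0 dot0r.
have dot_sum_le0 h (c : nat -> R) : (forall i, 0 <= c i) ->
    (forall i, (i < k)%N -> dot h (v i) <= 0) ->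
    dot h (\sum_(i < k) c i *: v i) <= 0.
  move=> c0 hv; rewrite dot_sumr; apply: sumr_le0 => i _.
  by rewrite dotZr mulr_ge0_le0 // hv.
set u := v k.
have extend (c : nat -> R) d :
    \sum_(i < k.+1) (if i == k :> nat then d else c i) *: v i =
    \sum_(i < k) c i *: v i + d *: u.
  rewrite big_ord_recr /= eqxx; congr (_ + _); apply: eq_bigr => i _.
  by rewrite ltn_eqF.
have [c c0 /=] := IHk v g.
set q := \sum_(i < k) _ => -[gq_q gq_v].
have [gq_u|gq_u] := leP (dot (g - q) u) 0.
  exists (fun i => if i == k then 0 else c i) => [i|]; first by case: eqP.
  rewrite extend scale0r addr0 -/q; split=> // i.
  by rewrite ltnS leq_eqVlt => /orP[/eqP ->|/gq_v].
have u0 : u != 0 by apply: contraTneq gq_u => ->; rewrite dot0r ltxx.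
have uu0 : dot u u != 0 by rewrite dot_eq0.
pose perp y := y - (dot u y / dot u u) *: u.
have perpP y : dot (perp y) u = 0.
  by rewrite /perp !dotE (dotC u y); field.
have [c' c'0 /=] := IHk (fun i => perp (v i)) (perp g).
set q' := \sum_(i < k) c' i *: v i.
have -> : \sum_(i < k) c' i *: perp (v i) = perp q'.
  rewrite /perp /q' dot_sumr mulr_suml scaler_suml -sumrB.
  by apply: eq_bigr => i _; rewrite scalerBr dotZr scalerA mulrA.
move=> [h1 h2].
pose d := (dot u g - dot u q') / dot u u.
set p := q' + d *: u.
have gp : perp g - perp q' = g - p.
  by rewrite /perp /p /d; apply/rowP => i; rewrite !mxE; field.
have gp_u : dot (g - p) u = 0.
  by rewrite -gp dotDl dotNl !perpP subrr.
have gp_perp y : dot (g - p) (perp y) = dot (g - p) y.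
  by rewrite /perp dotDr dotNr dotZr gp_u mulr0 oppr0 addr0.
have gp_v i : (i < k)%N -> dot (g - p) (v i) <= 0.
  by move=> /h2; rewrite gp gp_perp.
have gp_p : dot (g - p) p = 0.
  by rewrite {2}/p dotDr dotZr gp_u mulr0 addr0 -gp_perp -gp.
have d0 : 0 <= d.
  have := dot_ge0 (p - q); rewrite (dot_sub_residuals g) gp_p gq_q.
  have -> : dot (g - q) p = dot (g - q) q' + d * dot (g - q) u.
    by rewrite /p dotDr dotZr.
  have := dot_sum_le0 (g - q) _ c'0 gq_v; rewrite -/q' => gq_q'.
  have := dot_sum_le0 (g - p) _ c0 gp_v; rewrite -/q => gp_q pq.
  by rewrite -(pmulr_lge0 _ gq_u); lra.
exists (fun i => if i == k then d else c' i) => [i|]; first by case: eqP.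
rewrite extend -/q' -/p; split=> // i.
by rewrite ltnS leq_eqVlt => /orP[/eqP ->|/gp_v //]; rewrite gp_u.
Qed.

Lemma cone_atD C x p q : @convex_set R 'rV[R]_n C ->
  cone_at C x p -> cone_at C x q -> cone_at C x (p + q).
Proof.
move=> /convex_setE cC [a /= a0 [y Cy <-]] [b /= b0 [z Cz <-]].
have [ab0|abn] := eqVneq (a + b) 0.
  have [-> ->] : a = 0 /\ b = 0 by lra.
  by exists 0 => //=; exists y => //; rewrite !scale0r addr0.
have ab : 0 < a + b by rewrite lt_neqAle eq_sym abn addr_ge0.
exists (a + b) => /=; first exact: ltW.
exists ((a / (a + b)) *: y + (1 - a / (a + b)) *: z).
  by apply: cC => //; rewrite ?divr_ge0 ?ler_pdivrMr ?mul1r ?lerDl // ltW.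
rewrite !scalerBr scalerDr !scalerA mulrBr mulr1 mulrCA mulfV // mulr1.
by rewrite [a + b - a]addrAC subrr add0r scalerDl opprD addrACA.
Qed.

Lemma cone_atZ C x t p : 0 <= t -> cone_at C x p -> cone_at C x (t *: p).
Proof.
move=> t0 [a /= a0 [y Cy <-]]; exists (t * a); first exact: mulr_ge0.
by exists y => //; rewrite scalerA.
Qed.

(** The point [p] of [cone_projection] lies in the cone of [Om - x]; the
    half-space [dot (g - p) z <= 0] is closed, hence contains the tangent cone,
    so that [p] is the unique nearest point. *)
Lemma eproj_tangent_cone (A : set 'rV[R]_n) x g (Om := conv_hull A)
    (r := eproj (tangent_cone Om x) g) :
  finite_set A -> Om x ->
  [/\ cone_at Om x r, dot (g - r) r = 0 &
      forall y, Om y -> dot (g - r) (y - x) <= 0].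
Proof.
move=> finA Omx; have [s us As] := finite_uniq_seq finA.
have [c c0] := cone_projection (size s) (fun i => nth 0 s i - x) g.
pose p : 'rV[R]_n := \sum_(i < size s) c i *: (nth 0 s i - x).
rewrite /= -/p => -[gp_p gp_v].
have cOm : @convex_set R 'rV[R]_n Om by exact: convex_conv_hull.
have cone_p : cone_at Om x p.
  rewrite /p; elim/big_ind : _ => [|a b|i _].
  - by exists 0 => //=; exists x => //; rewrite scale0r.
  - exact: cone_atD.
  - apply: cone_atZ => //; exists 1 => //=.
    exists (nth 0 s i); last by rewrite scale1r.
    by apply: sub_conv_hull; rewrite As /=; apply: mem_nth.
have gp_Om y : Om y -> dot (g - p) (y - x) <= 0.
  apply: (@smallest_sub _ _ _ [set y | dot (g - p) (y - x) <= 0]).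
    exact: convex_halfspace.
  move=> a; rewrite As /= => /(nthP 0)[i si <-].
  exact: gp_v.
have gp_T z : tangent_cone Om x z -> dot (g - p) z <= 0.
  have sub : cone_at Om x `<=` [set z | dot (g - p) z <= 0].
    by move=> _ [t /= t0 [y Omy <-]]; rewrite dotZr mulr_ge0_le0 // gp_Om.
  by move=> /(closureS sub); rewrite -(closure_id _).1 //; exact: closed_halfspace.
have T_p : tangent_cone Om x p by exact: subset_closure.
have split_dist (z : 'rV[R]_n) : dot (g - z) (g - z) =
    dot (g - p) (g - p) - 2 * dot (g - p) z + dot (p - z) (p - z).
  by rewrite (dot_sub_sub g p z) (dotDr (g - p) p) dotNr gp_p; ring.
have argmin_p : argmin (tangent_cone Om x) (fun p => enorm (g - p)) p.
  split=> // z Tz; rewrite enorm_le (split_dist z).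
  have := gp_T _ Tz; have := dot_ge0 (p - z); lra.
suff -> : r = p by [].
have [Tr] : argmin (tangent_cone Om x) (fun p => enorm (g - p)) r.
  by apply: xgetPex; exists p.
move=> /(_ p T_p); rewrite enorm_le (split_dist r).
have := gp_T _ Tr; have := dot_ge0 (p - r) => h1 h2 h3.
have /eqP : dot (p - r) (p - r) = 0 by lra.
by rewrite dot_eq0 subr_eq0 => /eqP.
Qed.

Lemma face_exposed C u x : @convex_set R 'rV[R]_n C ->
  (forall y, C y -> dot u (y - x) <= 0) ->
  face C (C `&` [set y | dot u (y - x) = 0]).
Proof.
move=> cC uC; split; first by move=> y [].
  apply/convex_setE => y z t [Cy uy] [Cz uz] t0 t1; split.
    by move/convex_setE: cC; apply.
  by move: uy uz; rewrite /= !dotE; nra.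
move=> y z t Cy Cz /andP[t0 t1] [_ /=].
have := uC y Cy; have := uC z Cz; rewrite !dotE => uz uy uyz.
have [uy0 uz0] : dot u y - dot u x = 0 /\ dot u z - dot u x = 0 by nra.
by split; split.
Qed.

(** Test the pyramidal width on the face [F] of [Om] exposed at [x] by [g - r],
    in the direction [r]: there [dot r (a - s) = dot g (a - s)]. *)
Lemma PWidth_le_proj (A S : set 'rV[R]_n) x g M :
  finite_set A -> conv_hull A x -> active_sets A x S ->
  proj_norm (conv_hull A) x g != 0 ->
  (forall a s, conv_hull A a -> S s -> dot g (a - s) <= M) ->
  (PWidth A <= (M / proj_norm (conv_hull A) x g)%:E)%E.
Proof.
move=> finA Omx aS pn0 hM.
have [] := eproj_tangent_cone g finA Omx; set r := eproj _ _.
rewrite -/(proj_norm _ _ _) -/r; set Om := conv_hull A.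
move=> [t /= t0 [y Omy tyx]] gr_r gr_Om.
have rho0 : 0 < enorm r by rewrite lt_neqAle eq_sym pn0 enorm_ge0.
have r0 : r != 0 by rewrite -enorm_eq0.
have tn0 : t != 0 by apply: contraNneq r0 => t00; rewrite -tyx t00 scale0r.
pose F := Om `&` [set y | dot (g - r) (y - x) = 0].
have faceF : face Om F by apply: face_exposed => //; exact: convex_conv_hull.
have Fx : F x by split=> //=; rewrite subrr dot0r.
have Fy : F y.
  split=> //=; apply/eqP; move/eqP: gr_r.
  by rewrite -{2}tyx dotZr mulf_eq0 (negPf tn0).
have SF : S `<=` F by exact: active_set_sub_face faceF Fx aS.
apply: ge_ereal_inf; exists (PdirW (F `&` A) r x).
  by exists F, x, r; split=> //; exists t => //; exists y.
apply: ge_ereal_inf.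
exists (ereal_sup [set (dot ((enorm r)^-1 *: r) (a - s))%:E | a in F `&` A & s in S]).
  exists S => //; have [SA wS] := aS; split=> // s Ss.
  by split; [exact: SF|exact: SA].
apply: ge_ereal_sup => _ [a [Fa Aa] [s Ss <-]]; rewrite lee_fin.
rewrite dotZl mulrC ler_pM2r ?invr_gt0 //.
have [_ /= ra] := Fa; have [_ /= rs] := SF _ Ss.
have := hM a s (sub_conv_hull Aa) Ss.
move: ra rs; rewrite !dotE; lra.
Qed.

(** Positivity of the diameter implies that [C] is bounded, as the supremum of an
    unbounded set is [0]. *)
Lemma enorm_le_diameter (C : set 'rV[R]_n) x y :
  0 < diameter C -> C x -> C y -> enorm (x - y) <= diameter C.
Proof.
move=> D0 Cx Cy; apply: sup_upper_bound; last by exists x => //; exists y.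
by apply: contrapT => /sup_out E; move: D0; rewrite /diameter E ltxx.
Qed.

Lemma diameter_gt0_neq (C : set 'rV[R]_n) :
  0 < diameter C -> exists x y, [/\ C x, C y & x != y].
Proof.
move=> D0; have [|_ [x Cx [y Cy <-]] xy] := sup_gt _ D0.
  apply: contrapT => /nonemptyPn E.
  by move: D0; rewrite /diameter E sup0 ltxx.
exists x, y; split=> //; apply: contraTneq xy => ->.
by rewrite subrr -leNgt /enorm dot0r sqrtr0.
Qed.

(** Test the width on the face [Om] itself, at a point [x] and in the direction
    of another point, and apply the Cauchy-Schwarz inequality. *)
Lemma PWidth_le_diameter (A : set 'rV[R]_n) : finite_set A ->
  0 < diameter (conv_hull A) -> (PWidth A <= (diameter (conv_hull A))%:E)%E.
Proof.
move=> finA D0; have [x [y [Omx Omy xy]]] := diameter_gt0_neq D0.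
have g0 : y - x != 0 by rewrite subr_eq0 eq_sym.
have [S aS] := active_set_exists finA Omx.
apply: ge_ereal_inf; exists (PdirW (conv_hull A `&` A) (y - x) x).
  exists (conv_hull A), x, (y - x); split=> //.
    by split=> //; exact: convex_conv_hull.
  by exists 1 => //=; exists y => //; rewrite scale1r.
have -> : conv_hull A `&` A = A by apply/setIidr; exact: sub_conv_hull.
apply: ge_ereal_inf; eexists; first by exists S.
apply: ge_ereal_sup => _ [a Aa [s Ss <-]]; rewrite lee_fin.
have rho0 : 0 < enorm (y - x) by rewrite lt_neqAle eq_sym enorm_eq0 g0 enorm_ge0.
rewrite dotZl mulrC ler_pdivrMr // mulrC.
apply: le_trans (cauchy_schwarz _ _) _.
rewrite ler_wpM2l ?enorm_ge0 //; apply: enorm_le_diameter => //.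
  exact: sub_conv_hull.
by have [SA _] := aS; apply: sub_conv_hull; exact: SA.
Qed.

End Cones.
(** * A polytope is the convex hull of its vertices *)

Section Vertices.
Variables (R : realType) (n : nat).
Implicit Types (A : set 'rV[R]_n) (a x y : 'rV[R]_n).

Lemma conv_hullS (A B : set 'rV[R]_n) :
  A `<=` conv_hull B -> conv_hull A `<=` conv_hull B.
Proof. by move=> AB; apply: smallest_sub => //; exact: convex_conv_hull. Qed.

Lemma convex_set1 a : @convex_set R 'rV[R]_n [set a].
Proof.
apply/convex_setE => x y t -> -> _ _; rewrite -scalerDl.
by rewrite addrC subrK scale1r.
Qed.

(** An active set of a vertex [v] is nonempty and contained in the face [[set v]]. *)
Lemma vertices_sub A : finite_set A -> vertices (conv_hull A) `<=` A.
Proof.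
move=> finA v fv; have [vA _ _] := fv.
have [S aS] := active_set_exists finA (vA _ erefl).
have Sv := active_set_sub_face finA fv erefl aS.
have [s [w [[_ Ss] _ w1 _]]] := active_set_combo finA aS.
have [SA _] := aS; case: s Ss w1 => [|b s] Ss; first by rewrite big_nil; lra.
have Sb : S b by rewrite Ss /= mem_head.
by move=> _; rewrite -(Sv _ Sb); exact: SA.
Qed.

(** If [a = t x + (1 - t) y], then combining the weights of [x] and [y] gives a
    convex combination of [s] equal to [a]. Either [a] has weight [1] in it, and
    then also in [x] and [y], so that [x = y = a]; or [a] can be solved for in
    terms of the other points. *)
Lemma nonvertex_conv_hull (s : seq 'rV[R]_n) a : uniq s -> a \in s ->
  ~ vertices (conv_hull [set` s]) a ->
  conv_hull [set` [seq b <- s | b != a]] a.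
Proof.
move=> us sa nva; apply: contrapT => na; apply: nva; split.
- by move=> _ ->; exact: sub_conv_hull.
- exact: convex_set1.
move=> x y t /(conv_hull_combo us)[w [w0 w1 wx]].
move=> /(conv_hull_combo us)[w' [w'0 w'1 w'y]] /andP[t0 t1] /= ea.
have all_on_a (c : 'rV[R]_n -> R) (z : 'rV[R]_n) : (forall b, 0 <= c b) ->
    \sum_(b <- s) c b = 1 -> \sum_(b <- s) c b *: b = z -> c a = 1 -> z = a.
  move=> c0 c1 <- ca; rewrite (bigD1_seq a) //= ca scale1r.
  move: c1; rewrite (bigD1_seq a) //= ca => /(canRL (addKr _)).
  rewrite addNr => /eqP; rewrite psumr_eq0 // => /allP cz.
  rewrite big_seq_cond big1 ?addr0 // => b /andP[bs ba].
  by have := cz _ bs; rewrite ba => /eqP ->; rewrite scale0r.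
pose z b := t * w b + (1 - t) * w' b.
have z0 b : 0 <= z b by rewrite addr_ge0 // mulr_ge0 // ?subr_ge0 ltW.
have z1 : \sum_(b <- s) z b = 1.
  by rewrite big_split /= -!big_distrr /= w1 w'1; ring.
have za : \sum_(b <- s) z b *: b = a.
  rewrite -[RHS]ea -wx -w'y !scaler_sumr -big_split /=; apply: eq_bigr => b _.
  by rewrite !(scalerA, =^~ scalerDl).
have le1 (c : 'rV[R]_n -> R) : (forall b, 0 <= c b) ->
    \sum_(b <- s) c b = 1 -> c a <= 1.
  by move=> c0 <-; rewrite (bigD1_seq a) //= lerDl; apply: sumr_ge0.
have [za1|zan1] := eqVneq (z a) 1.
  have := le1 _ w0 w1; have := le1 _ w'0 w'1; rewrite /z in za1 => w'a wa.
  have wa1 : w a = 1 by nra.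
  have w'a1 : w' a = 1 by nra.
  by split; [exact: all_on_a wx wa1|exact: all_on_a w'y w'a1].
exfalso; apply: na.
have zlt1 : 1 - z a != 0 by rewrite subr_eq0 eq_sym.
have za_le1 := le1 _ z0 z1.
move: za z1; rewrite !(bigD1_seq a) //= => za z1.
have aE : a = \sum_(b <- [seq b <- s | b != a]) ((1 - z a)^-1 * z b) *: b.
  under eq_bigr do rewrite -scalerA.
  rewrite -scaler_sumr big_filter; apply: (scalerI zlt1).
  rewrite scalerA mulfV // scale1r scalerBl scale1r.
  by rewrite -[X in X - _]za addrAC subrr add0r.
rewrite [X in conv_hull _ X]aE.
apply: convex_sum; first exact: convex_conv_hull.
- by move=> b _; rewrite mulr_ge0 // invr_ge0 subr_ge0.
- by move=> b bs; apply: sub_conv_hull; exact: bs.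
- rewrite -big_distrr big_filter /=.
  have -> : \sum_(b <- s | b != a) z b = 1 - z a by lra.
  exact: mulVf.
Qed.

(** Discard the points of [A] that are not vertices one at a time: neither the
    hull nor, therefore, its vertices change. *)
Lemma conv_hull_vertices A : finite_set A ->
  conv_hull (vertices (conv_hull A)) = conv_hull A.
Proof.
move=> finA; apply/seteqP; split.
  by apply: conv_hullS => a [aA _ _]; exact: aA.
have [s us ->] := finite_uniq_seq finA.
have [k] := ubnP (size s); elim: k s us => // k IHk s us.
rewrite ltnS => sk.
have [allv|/existsNP[a /not_implyP[/= sa nva]]] :=
  pselect (forall a, [set` s] a -> vertices (conv_hull [set` s]) a).
  by apply: conv_hullS => a sa; apply: sub_conv_hull; exact: allv.
have aE := nonvertex_conv_hull us sa nva.
have hullE : conv_hull [set` [seq b <- s | b != a]] = conv_hull [set` s].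
  apply/seteqP; split; apply: conv_hullS => b /=.
    by rewrite mem_filter => /andP[_ bs]; exact: sub_conv_hull.
  have [-> //|ba bs] := eqVneq b a.
  by apply: sub_conv_hull; rewrite /= mem_filter ba.
rewrite -hullE; apply: IHk; first exact: filter_uniq.
apply: leq_trans sk; rewrite size_filter -[ltnRHS](count_predC (pred1 a)).
by rewrite -[ltnLHS]add0n ltn_add2r -has_count has_pred1.
Qed.

End Vertices.

(** * Slope bounds *)

Section SlopeBounds.
Variables (R : realType) (n : nat).
Implicit Types (A : set 'rV[R]_n) (x g d s q : 'rV[R]_n).

(** For [d != 0], bound [enorm d] by [D] and clear denominators. For [d = 0] the
    right-hand side is [0 / 0], that is [0], while [M <= k * dot g d = 0] makes
    the left-hand side nonpositive. *)
Lemma slope_bound (W : \bar R) (D rho k M : R) g d :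
  0 < D -> 0 < rho -> 0 < k -> (W <= (M / rho)%:E)%E ->
  M <= k * dot g d -> 0 <= dot g d -> enorm d <= D ->
  (W / (k * D)%:E <= (dot g d / (rho * enorm d))%:E)%E.
Proof.
move=> D0 rho0 k0 WM Mgd gd0 dD.
have kD0 : 0 < k * D by rewrite mulr_gt0.
rewrite inver gt_eqF // lee_pdivrMr // (le_trans WM) // -EFinM lee_fin.
rewrite ler_pdivrMr // (le_trans Mgd) //.
have [d0|dn0] := eqVneq (enorm d) 0.
  have -> : d = 0 by apply/eqP; rewrite -enorm_eq0 d0.
  by rewrite dot0r mulr0 !mul0r.
have d0 : 0 < enorm d by rewrite lt_neqAle eq_sym dn0 enorm_ge0.
have -> : dot g d / (rho * enorm d) * (k * D) * rho =
    k * dot g d * (D / enorm d) by field; rewrite !gt_eqF.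
by rewrite ler_peMr ?ler_pdivlMr ?mul1r // mulr_ge0 // ltW.
Qed.

(** The bound [W <= diameter Om] and [1 <= k] serve at the stationary points,
    where the slope is [1] by convention; elsewhere [slope_bound] applies. *)
Lemma SB_ge (W : \bar R) (Om : set 'rV[R]_n) (M : method R n) (k : R) :
  0 < diameter Om -> 1 <= k -> (W <= (diameter Om)%:E)%E ->
  (forall x g d, Om x -> proj_norm Om x g != 0 -> M x g d ->
     [/\ exists2 m, (W <= (m / proj_norm Om x g)%:E)%E & m <= k * dot g d,
         0 <= dot g d & enorm d <= diameter Om]) ->
  (W / (k * diameter Om)%:E <= SB Om (zero_if_stationary Om M))%E.
Proof.
move=> D0 k1 WD hM; have k0 : 0 < k by rewrite (lt_le_trans ltr01).
apply: le_ereal_inf_tmp => _ [x Omx [g _ <-]]; rewrite /DSB.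
case: eqP => [_|/eqP pn0].
  have kD0 : 0 < k * diameter Om by rewrite mulr_gt0.
  rewrite inver gt_eqF // lee_pdivrMr // mul1e (le_trans WD) // lee_fin.
  by rewrite ler_peMl // ltW.
apply: le_ereal_inf_tmp => _ [d + <-]; rewrite /zero_if_stationary (negPf pn0).
move=> /(hM _ _ _ Omx pn0)[[m Wm mk] gd0 dD].
apply: (slope_bound (M := m)) => //.
by rewrite lt_neqAle eq_sym pn0 /proj_norm enorm_ge0.
Qed.

Lemma dot_le_argmax_argmin (C S : set 'rV[R]_n) g s q a b :
  argmax C (dot g) s -> argmin S (dot g) q -> C a -> S b ->
  dot g (a - b) <= dot g (s - q).
Proof.
move=> [_ hs] [_ hq] Ca Sb; have := hs _ Ca; have := hq _ Sb.
rewrite !dotE; lra.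
Qed.

(** One of the two directions [s - x], [x - q] has at least half of the slope
    of their sum [s - q]. *)
Lemma dot_le_twice_argmax (E : set 'rV[R]_n) x g s q d :
  argmax E (dot g) d -> E (s - x) -> E (x - q) ->
  dot g (s - q) <= 2 * dot g d.
Proof.
move=> [_ hd] /hd h1 /hd; move: h1; rewrite !dotE; lra.
Qed.

End SlopeBounds.

Local Open Scope ereal_scope.

Theorem proposition6p3 (R : realType) (n : nat) (A : set 'rV[R]_n)
    (finA : finite_set A) (diam_gt0 : (0 < diameter (conv_hull A))%R) :
  [/\ PWidth A / (diameter (conv_hull A))%:E <= SB (conv_hull A) (PFW A),
      PWidth A / (2 * diameter (conv_hull A))%R%:E <= SB (conv_hull A) (AFW A) &
      PWidth (vertices (conv_hull A)) / (2 * diameter (conv_hull A))%R%:E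
        <= SB (conv_hull A) (FD (conv_hull A))].
Proof.
set Om := conv_hull A.
have dist_le x y : Om x -> Om y -> (enorm (x - y) <= diameter Om)%R.
  exact: enorm_le_diameter.
have active_sub x S : active_sets A x S -> S `<=` Om.
  by move=> [SA _] y /SA; exact: sub_conv_hull.
split.
- rewrite -[diameter Om]mul1r; apply: SB_ge => //.
    exact: PWidth_le_diameter.
  move=> x g _ Omx pn0 [s [S [q [sE aS qE ->]]]].
  have [Oms maxs] := sE; have [Sq _] := qE.
  have Omq := active_sub _ _ aS _ Sq.
  split; last exact: dist_le.
    exists (dot g (s - q)); last by rewrite mul1r.
    apply: PWidth_le_proj aS pn0 _ => // a b Oma Sb.
    exact: dot_le_argmax_argmin sE qE Oma Sb.
  by have := maxs _ Omq; rewrite dotDr dotNr subr_ge0.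
- apply: SB_ge => //; [exact: ler1n|exact: PWidth_le_diameter|].
  move=> x g d Omx pn0 [_ [S [q [[s sE <-] aS qE dE]]]].
  have [Oms maxs] := sE; have [Sq _] := qE.
  have Omq := active_sub _ _ aS _ Sq.
  split.
  + exists (dot g (s - q)).
      apply: PWidth_le_proj aS pn0 _ => // a b Oma Sb.
      exact: dot_le_argmax_argmin sE qE Oma Sb.
    by apply: (dot_le_twice_argmax (x := x) dE); [left|right].
  + have [_ /(_ (s - x)%R (or_introl erefl))] := dE; apply: le_trans.
    by have := maxs _ Omx; rewrite dotDr dotNr subr_ge0.
  + by have [[->|->] _] := dE; exact: dist_le.
have finV : finite_set (vertices Om).
  exact: sub_finite_set (vertices_sub finA) finA.
have VE : conv_hull (vertices Om) = Om by exact: conv_hull_vertices.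
apply: SB_ge => //; first exact: ler1n.
  by rewrite -{2}VE; apply: PWidth_le_diameter => //; rewrite VE.
move=> x g d Omx pn0 [_ [xA [[s sE <-] xAE dE]]].
have [Oms maxs] := sE; have [xAm _] := xAE.
have OmxA : Om xA.
  apply: (xAm Om); split; last by move=> _ ->.
  by split=> //; exact: convex_conv_hull.
split.
(* The active set consists of vertices, while [xA] minimizes over the minimal
   face; the latter contains the former. *)
- exists (dot g (s - xA)); last first.
    by apply: (dot_le_twice_argmax (x := x) dE); [right|left].
  have [S aS] : exists S, active_sets (vertices Om) x S.
    by apply: active_set_exists => //; rewrite VE.
  have := @PWidth_le_proj _ _ (vertices Om) S x g (dot g (s - xA)).
  rewrite VE; apply=> // a b Oma Sb.
  apply: dot_le_argmax_argmin sE xAE Oma _ => F [faceF Fx].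
  apply: (active_set_sub_face finV _ _ aS) Sb; first by rewrite VE.
  exact: Fx.
- have [_ /(_ (s - x)%R (or_intror erefl))] := dE; apply: le_trans.
  by have := maxs _ Omx; rewrite dotDr dotNr subr_ge0.
- by have [[->|->] _] := dE; exact: dist_le.
Qed.
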